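(* Let $X$ be a non-empty finite set, $\mu\in\Delta(X)$, let $F:\Delta(X)\to\mathbb{R}$, $F(\nu)=\max_{a\in A}E_\nu[u(a,x)]$, be continuous, let $H:\Delta(X)\to\mathbb{R}$ be the entropy function, and let $f:\mathbb{R}\to\mathbb{R}$ be continuous and convex. Then there exists $P^*\in\Delta^2(X)$ with $|\mathrm{supp}(P^* )|\le 2|X|$ that solves $$\sup_{\substack{P\in\Delta^2(X)\\ E_P[\nu]=\mu}} E_P[F(\nu)]-f\left(E_P[H(\mu)-H(\nu)]\right).$$ Moreover, if $f$ is differentiable, $P^*$ satisfies $$P^*\in\arg\max_{\substack{P\in\Delta^2(X)\\ E_P[\nu]=\mu}} E_P\left[F(\nu)+f'\left(E_{P^*}[H(\mu)-H(\nu)]\right)\cdot H(\nu)\right].$$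
   Context: $\Delta(X)\subset\mathbb{R}^{|X|}$ is the simplex of probability measures on the finite set $X$, and $\Delta^2(X)$ is the set of all Borel probability measures on $\Delta(X)$. For $P\in\Delta^2(X)$, $E_P[\nu]=\int_{\Delta(X)}\nu\,dP(\nu)$ is the barycenter and $E_P[V(\nu)]=\int_{\Delta(X)}V(\nu)\,dP(\nu)$; $\mathrm{supp}(P)$ is its support. $A$ is a set of actions and $u:A\times X\to\mathbb{R}$ a utility function such that the maximum defining $F$ is attained; $E_\nu[u(a,x)]=\sum_{x\in X}\nu(x)u(a,x)$. The entropy is $H(\nu)=-\sum_{x\in X}\nu(x)\log\nu(x)$ with $0\log0=0$. ''$P^*$ solves'' the problem means it is feasible and attains the supremum. *)

(* Defs.v *)
From HB Require Import structures.
From mathcomp Require Import all_boot all_order all_algebra.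
From mathcomp Require Import all_classical all_reals all_analysis.
Set Implicit Arguments.
Unset Strict Implicit.
Unset Printing Implicit Defensive.
Import Order.TTheory GRing.Theory Num.Theory.
Import numFieldNormedType.Exports.

Local Open Scope classical_set_scope.
Local Open Scope ring_scope.

Definition simplex (R : realType) (X : finType) : set {ptws X -> R} :=
  [set nu | (forall x, 0 <= nu x) /\ \sum_(x : X) nu x = 1].

Lemma simplex_uniform (R : realType) (X : finType) (X0 : (0 < #|X|)%N) :
  (fun _ : X => #|X|%:R^-1 : R) \in @simplex R X.
Proof.
apply/mem_set; split=> [x|]; first by rewrite invr_ge0 ler0n.
by rewrite sumr_const -[LHS]mulr_natr mulVf// pnatr_eq0 -lt0n.
Qed.

(* The simplex as a type, with the topology induced by R^X. A measurableType
   must be pointed: the proof that X is non-empty, carried by the type, is used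
   only to provide that point. *)
Definition Delta (R : realType) (X : finType) (X0 : (0 < #|X|)%N) : Type :=
  set_type (@simplex R X).

HB.instance Definition _ (R : realType) (X : finType) (X0 : (0 < #|X|)%N) :=
  Topological.copy (Delta R X0) (set_type (@simplex R X)).

HB.instance Definition _ (R : realType) (X : finType) (X0 : (0 < #|X|)%N) :=
  isPointed.Build (Delta R X0)
    (exist (fun nu => nu \in @simplex R X) _ (simplex_uniform R X0)).

(* Delta carries its Borel sigma-algebra, so that probability (Delta R X0) R is
   the set of Borel probability measures on the simplex. *)
HB.instance Definition _ (R : realType) (X : finType) (X0 : (0 < #|X|)%N) :=
  Measurable.copy (Delta R X0) (g_sigma_algebraType (@open (Delta R X0))).

Definition mass (R : realType) (X : finType) (X0 : (0 < #|X|)%N)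
  (nu : Delta R X0) : X -> R := set_val nu.
Coercion mass : Delta >-> Funclass.

Section definitions.
Context {R : realType} {X : finType} {X0 : (0 < #|X|)%N}.
Implicit Types (mu nu : Delta R X0) (P : probability (Delta R X0) R).

Definition expected_utility (A : Type) (u : A -> X -> R) nu (a : A) : R :=
  \sum_(x : X) nu x * u a x.

Definition is_max (S : set R) (m : R) : Prop := S m /\ ubound S m.

(* 0 log 0 = 0 holds because of the factor nu x. *)
Definition entropy nu : R := - \sum_(x : X) nu x * ln (nu x).

(* The integrals are real-valued (Rintegral); the integrands are continuous on
   the compact simplex, hence integrable. *)
Definition feasible mu : set (probability (Delta R X0) R) :=
  [set P | forall x, \int[P]_nu (nu : Delta R X0) x = mu x].

Definition supp P : set (Delta R X0) :=
  [set nu | forall U : set (Delta R X0), open U -> U nu -> (0 < P U)%E].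

End definitions.

Definition solves_sup (R : realType) (T : Type) (S : set T) (g : T -> R)
    (s : T) : Prop :=
  S s /\ (g s)%:E = ereal_sup [set (g t)%:E | t in S].

Definition argmax (R : realType) (T : Type) (S : set T) (g : T -> R) : set T :=
  [set s | S s /\ forall t, S t -> g t <= g s].

(* Main.v *)
Require Import Defs.
From HB Require Import structures.
From mathcomp Require Import all_boot all_order all_algebra.
From mathcomp Require Import all_classical all_reals all_analysis.
From mathcomp Require Import measurable_realfun.
From mathcomp Require Import ring lra.
Import Order.TTheory GRing.Theory Num.Theory.
Import numFieldNormedType.Exports.
Set Implicit Arguments.
Unset Strict Implicit.
Unset Printing Implicit Defensive.
Local Open Scope classical_set_scope.
Local Open Scope ring_scope.
Local Open Scope card_scope.

(** A probability P on the simplex enters the problem only through finitely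
    many numbers, the moments E_P[nu x] for x in X, E_P[F] and E_P[H].  Write
    g nu for the vector of the #|X| + 2 values nu x, F nu, H nu.  The whole
    problem can then be read on the set C of all means of g.

    The key point is that C is already filled by mixtures of #|X| + 2 points.
    One inclusion is [probability_of_mixture].  For the other one
    ([mean_is_mixture]), let p be the mean of g under P.  Mixtures of #|X| + 2
    points form a compact space on which the moments are continuous, so some
    mixture has a moment vector q closest to p.  By Caratheodory's theorem
    ([caratheodory]) the moment vectors of such mixtures form a convex set
    containing every g nu, so the vector p - q makes an obtuse angle with every
    g nu - q; integrating this inequality over P gives |p - q|^2 <= 0
    ([mean_eq_closest]).  Caratheodory's theorem is used in its conic form, in
    dimension #|X| + 2: since the masses nu x add up to 1, the total weight of
    a mixture is a linear function of its moments, so that no additional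
    coordinate, hence no additional point, is needed to keep track of it.

    Existence now is the extreme value theorem on the compact set of mixtures
    with barycenter mu ([optimal_posteriors]), all functions involved being
    continuous; for the entropy this is [continuous_xlnx].  The optimal mixture
    has at most #|X| + 2 atoms, which is at most 2 #|X| as soon as X has two
    elements; when X is a singleton the simplex is a point.

    The last claim is the first-order condition of this problem.  The pairs
    (E_P[F], E_P[H]) with P of barycenter mu form a convex set, so the segment
    from the optimal pair to any other one stays feasible, and the one-sided
    derivative of the objective along it is nonpositive
    ([one_sided_derivative_bound]).  This derivative is the difference of the
    two values of the linearized objective. *)

(** * Finite mixtures and Caratheodory's theorem *)

Lemma positive_linear_relation (R : realFieldType) (I : finType) (k : nat)
    (v : I -> 'I_k -> R) : (#|I| < k)%N ->
  exists2 u : 'I_k -> R, exists j, 0 < u j &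
    forall i, \sum_j u j * v i j = 0.
Proof.
move=> Ik.
pose M : 'M[R]_(k, #|I|) := \matrix_(j, i) v (enum_val i) j.
have /rowV0Pn[r /sub_kermxP rM0 r0] : kermx M != 0.
  by rewrite kermx_eq0 -row_leq_rank -ltnNge (leq_ltn_trans (rank_leq_col M)).
have ker i : \sum_j r 0 j * v i j = 0.
  transitivity ((r *m M) 0 (enum_rank i)); last by rewrite rM0 mxE.
  by rewrite mxE; apply: eq_bigr => j _; rewrite mxE enum_rankK.
have [j rj] : exists j, r 0 j != 0 by apply/rV0Pn.
have [rpos|rneg] := ltP 0 (r 0 j); first by exists (r 0); [exists j|].
exists (fun j => - r 0 j); first by exists j; rewrite oppr_gt0 lt_neqAle rj.
by move=> i; under eq_bigr do rewrite mulNr; rewrite sumrN ker oppr0.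
Qed.

Section mixed_moments.
Context {R : realFieldType} {T : Type} {I : finType} (g : I -> T -> R).
Implicit Types (th : nat -> R * T).

(** A mixture is a sequence of weighted points, of which only the first [k]
    count.  Sequences indexed by [nat], rather than by a finite type, let [k]
    vary freely. *)
Definition mixed (k : nat) th (i : I) : R :=
  \sum_(j < k) (th j).1 * g i (th j).2.

(** When there are more points than moments, the weights can be moved along a
    linear relation between the points without changing any moment, until the
    first weight vanishes. *)
Lemma drop_point k th : (#|I| < k.+1)%N -> (forall j, 0 <= (th j).1) ->
  exists2 th', (forall j, 0 <= (th' j).1) & mixed k th' = mixed k.+1 th.
Proof.
move=> Ik th0.
have [u [j1 uj1] ker] :=
  positive_linear_relation (fun i (j : 'I_k.+1) => g i (th j).2) Ik.
(* The weight that vanishes first is the one minimizing the ratio of the weight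
   to the coefficient, among positive coefficients. *)
have [j0 uj0 minj0] := @arg_minP _ _ _ j1 (fun j => 0 < u j)
  (fun j : 'I_k.+1 => (th j).1 / u j) uj1.
pose s := (th j0).1 / u j0.
pose w (j : 'I_k.+1) := (th j).1 - s * u j.
have s0 : 0 <= s by rewrite divr_ge0// ltW.
have w0 j : 0 <= w j.
  rewrite subr_ge0; have [uj|uj] := ltP 0 (u j).
    by rewrite -ler_pdivlMr//; exact: minj0.
  by rewrite (le_trans _ (th0 j))// mulr_ge0_le0.
have wj0 : w j0 = 0 by rewrite /w /s divfK ?subrr// gt_eqF.
exists (fun j => if insub (bump j0 j) is Some j' then (w j', (th j').2)
                 else th j).
  by move=> j; case: insubP => [j' _ _|_]; [exact: w0|exact: th0].
apply/funext => i; rewrite /mixed [RHS](bigD1_ord j0)//=.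
transitivity (\sum_(j < k.+1) w j * g i (th j).2).
  rewrite [RHS](bigD1_ord j0)//= wj0 mul0r add0r; apply: eq_bigr => j _.
  by rewrite -[bump j0 j]/(nat_of_ord (lift j0 j)) valK.
rewrite -[RHS](bigD1_ord j0 (P := predT)
  (F := fun j => (th j).1 * g i (th j).2))//=.
under eq_bigr do rewrite mulrBl -mulrA; rewrite sumrB -mulr_sumr ker mulr0.
by rewrite subr0.
Qed.

(** The conic form of the theorem: total weights are not prescribed, which
    saves one point with respect to the affine form. *)
Lemma caratheodory k th : (forall j, 0 <= (th j).1) ->
  exists2 th', (forall j, 0 <= (th' j).1) &
    mixed #|I| th' = mixed k th.
Proof.
elim: k th => [|k IH] th th0.
  exists (fun j => (0, (th j).2)) => //; apply/funext => i.
  by rewrite /mixed big_ord0 big1// => j _; rewrite mul0r.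
have [kI|Ik] := leqP k.+1 #|I|; last first.
  have [th1 th10 <-] := drop_point Ik th0; exact: IH.
exists (fun j => (if (j < k.+1)%N then (th j).1 else 0, (th j).2)).
  by move=> j /=; case: ifP.
apply/funext => i; rewrite /mixed.
rewrite (big_ord_widen _ (fun j => (th j).1 * g i (th j).2) kI).
by rewrite [RHS]big_mkcond/=; apply: eq_bigr => j _; case: ifP; rewrite ?mul0r.
Qed.

Lemma mixedD k k' th th' a b :
  (forall j, 0 <= (th j).1) -> (forall j, 0 <= (th' j).1) ->
  0 <= a -> 0 <= b ->
  exists2 th'', (forall j, 0 <= (th'' j).1) &
   forall i, mixed (k + k') th'' i = a * mixed k th i + b * mixed k' th' i.
Proof.
move=> th0 th'0 a0 b0.
exists (fun j => if (j < k)%N then (a * (th j).1, (th j).2)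
                 else (b * (th' (j - k)%N).1, (th' (j - k)%N).2)).
  by move=> j; case: ifP => _; rewrite mulr_ge0.
move=> i; rewrite /mixed big_split_ord/= !mulr_sumr; congr +%R.
  by apply: eq_bigr => j _; rewrite ltn_ord mulrA.
by apply: eq_bigr => j _; rewrite ltnNge leq_addr/= addKn mulrA.
Qed.

End mixed_moments.

(** * The compact space of mixtures *)

Lemma continuous_add (R : realType) (S : topologicalType) (f h : S -> R) :
  continuous f -> continuous h -> continuous (fun x => f x + h x).
Proof. by move=> fc hc x; apply: cvgD; [exact: fc|exact: hc]. Qed.

Lemma continuous_mul (R : realType) (S : topologicalType) (f h : S -> R) :
  continuous f -> continuous h -> continuous (fun x => f x * h x).
Proof. by move=> fc hc x; apply: cvgM; [exact: fc|exact: hc]. Qed.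

Lemma continuous_compose (S S' S'' : topologicalType) (f : S -> S')
    (h : S' -> S'') :
  continuous f -> continuous h -> continuous (fun x => h (f x)).
Proof. by move=> fc hc x; apply: continuous_comp; [exact: fc|exact: hc]. Qed.

Lemma continuous_bigsum (R : realType) (S : topologicalType) (J : Type)
    (r : seq J) (F : J -> S -> R) :
  (forall j, continuous (F j)) -> continuous (fun x => \sum_(j <- r) F j x).
Proof.
move=> Fc x; apply: cvg_big => [|j _]; first exact: add_continuous.
exact: Fc.
Qed.

Section mixture_space.
Context {R : realType} {T : topologicalType} {I : finType} (g : I -> T -> R).
Variable c : I -> R.
Hypothesis c1 : forall x, \sum_i c i * g i x = 1.
Hypothesis g_cont : forall i, continuous (g i).

Local Notation params := (prod_topology (fun _ : nat => (R * T)%type)).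

(** The bounds on all the weights, including those from index [N] on, make this
    a subset of a product of compact spaces. *)
Definition mixtures (N : nat) : set params :=
  [set th | (forall j : nat, 0 <= (th j).1 <= 1) /\ \sum_(j < N) (th j).1 = 1].

Lemma total_weight k (th : nat -> R * T) :
  \sum_i c i * mixed g k th i = \sum_(j < k) (th j).1.
Proof.
under eq_bigr do rewrite mulr_sumr; rewrite exchange_big; apply: eq_bigr => j _.
by under eq_bigr do rewrite mulrCA; rewrite -mulr_sumr c1 mulr1.
Qed.

(** Caratheodory's theorem for convex combinations; by [total_weight], a
    mixture with the same moments also has the same total weight. *)
Lemma mixtures_realize k (th : nat -> R * T) : (forall j, 0 <= (th j).1) ->
  \sum_(j < k) (th j).1 = 1 ->
  exists2 th', mixtures #|I| th' & mixed g #|I| th' = mixed g k th.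
Proof.
move=> th0 th1; have [th' th'0 th'E] := caratheodory g k th0.
have sum1 : \sum_(j < #|I|) (th' j).1 = 1.
  by rewrite -total_weight -th1 -(total_weight k th) th'E.
(* Weights from index #|I| on are arbitrary, and are reset to stay in [0, 1]. *)
pose th2 j := (if (j < #|I|)%N then (th' j).1 else 0, (th' j).2).
have th2E (j : 'I_#|I|) : th2 j = th' j.
  by rewrite /th2 ltn_ord -surjective_pairing.
exists th2.
  split=> [j|]; last by under eq_bigr do rewrite th2E.
  rewrite /th2/=; case: ifP => // jI; last by rewrite lexx ler01.
  rewrite th'0 -sum1 (bigD1 (Ordinal jI))//= lerDl.
  by apply: sumr_ge0 => i _; exact: th'0.
rewrite -th'E; apply/funext => i; rewrite /mixed.
by under eq_bigr do rewrite th2E.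
Qed.

Lemma mixtures_point x :
  exists2 th, mixtures #|I| th & forall i, mixed g #|I| th i = g i x.
Proof.
have [||th thM thE] := @mixtures_realize 1 (fun=> (1, x)).
- by move=> _; exact: ler01.
- by rewrite big_ord1.
by exists th => // i; rewrite thE /mixed big_ord1 mul1r.
Qed.

Lemma mixtures_convex th th' t :
  mixtures #|I| th -> mixtures #|I| th' -> 0 <= t <= 1 ->
  exists2 th'', mixtures #|I| th'' & forall i, mixed g #|I| th'' i =
    (1 - t) * mixed g #|I| th i + t * mixed g #|I| th' i.
Proof.
move=> [th01 th1] [th'01 th'1] /andP[t0 t1].
have th0 j : 0 <= (th j).1 by case/andP: (th01 j).
have th'0 j : 0 <= (th' j).1 by case/andP: (th'01 j).
have t10 : 0 <= 1 - t by rewrite subr_ge0.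
have [h h0 hE] := mixedD g #|I| #|I| th0 th'0 t10 t0.
have h1 : \sum_(j < #|I| + #|I|) (h j).1 = 1.
  rewrite -total_weight.
  under eq_bigr do rewrite hE mulrDr mulrCA [X in _ + X]mulrCA.
  by rewrite big_split/= -!mulr_sumr !total_weight th1 th'1; ring.
have [th'' Mth'' th''E] := mixtures_realize h0 h1.
by exists th'' => // i; rewrite th''E hE.
Qed.

Lemma coord_continuous j : continuous (fun th : params => th j).
Proof. exact: (@proj_continuous _ (fun _ : nat => (R * T)%type)). Qed.

Lemma weight_continuous j : continuous (fun th : params => (th j).1).
Proof.
move=> th; apply: continuous_comp; first exact: coord_continuous.
exact: cvg_fst.
Qed.

Lemma mixed_continuous i : continuous (fun th : params => mixed g #|I| th i).
Proof.
apply: continuous_bigsum => j; apply: continuous_mul.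
  exact: weight_continuous.
apply: (continuous_compose _ (@g_cont i)).
apply: (continuous_compose (h := snd) (@coord_continuous j)) => p.
exact: cvg_snd.
Qed.

Lemma mixtures_compact : compact [set: T] -> compact (mixtures #|I|).
Proof.
move=> Tcpt.
have box : compact [set th : params |
    forall j : nat, (`[0, 1] `*` [set: T]) (th j)].
  apply: (@tychonoff _ (fun _ : nat => (R * T)%type)
    (fun _ => `[0, 1] `*` [set: T])) => _.
  by apply: compact_setX => //; exact: segment_compact.
apply: subclosed_compact box _; last first.
  by move=> th [th01 _] j; split=> //=; rewrite in_itv/=.
have -> : mixtures #|I| =
    \bigcap_(j in [set: nat]) ((fun th : params => (th j).1) @^-1` `[0, 1]) `&`
    ((fun th : params => \sum_(j < #|I|) (th j).1) @^-1` [set 1]).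
  apply/seteqP; split=> [th [th01 th1]|th [th01 th1]]; split=> // j.
    by move=> _; rewrite /= in_itv/=; exact: th01.
  by have := th01 j Logic.I; rewrite /= in_itv.
apply: closedI.
  apply: closed_bigI => j _.
  move/continuous_closedP: (@weight_continuous j); apply.
  exact: interval_closed.
have /continuous_closedP :
    continuous (fun th : params => \sum_(j < #|I|) (th j).1).
  by apply: continuous_bigsum => j; exact: weight_continuous.
apply; exact: closed_eq.
Qed.

End mixture_space.

(** * Means and closest points *)

(** A parabola through the origin, with slope -2a there, stays nonnegative for
    small positive t only if a is nonpositive. *)
Lemma quadratic_le0 (R : realFieldType) (a b : R) :
  (forall t, 0 <= t <= 1 -> 2 * t * a <= t ^+ 2 * b) -> a <= 0.
Proof.
move=> h; rewrite leNgt; apply/negP => a0.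
have [b0|b0] := leP b 0.
  by have := h 1; rewrite ler01 lexx => /(_ isT); nra.
have ab0 : 0 < a + b by rewrite addr_gt0.
have [t t0] : exists2 t, 0 < t & t * (a + b) = a.
  by exists (a / (a + b)); rewrite ?divr_gt0// divfK// gt_eqF.
rewrite mulrDr => tab.
have tb : t * b = a - t * a by lra.
have t01 : 0 <= t <= 1.
  rewrite ltW//= leNgt; apply/negP => t1.
  have : a < t * a by rewrite ltr_pMl.
  have : 0 < t * b by rewrite mulr_gt0.
  lra.
have := h t t01; rewrite expr2 -mulrA -[t * t * b]mulrA tb mulrBr.
have : 0 < t * a by rewrite mulr_gt0.
have : 0 < t * (t * a) by rewrite !mulr_gt0.
lra.
Qed.

Section mean.
Context {d : measure_display} {T : measurableType d} {R : realType}.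
Context {I : finType} (g : I -> T -> R) (P : probability T R).
Hypothesis g_int : forall i, P.-integrable [set: T] (EFin \o g i).

Lemma integrable_lincomb (a : I -> R) :
  P.-integrable [set: T] (EFin \o fun x => \sum_i a i * g i x).
Proof.
rewrite (_ : _ \o _ = fun x => (\sum_i (a i)%:E * (g i x)%:E)%E); last first.
  by apply/funext => x /=; rewrite -sumEFin.
by apply: integrable_sum => // i _; apply: integrableZl => //; exact: g_int.
Qed.

Lemma Rintegral_lincomb (a : I -> R) :
  \int[P]_x (\sum_i a i * g i x) = \sum_i a i * \int[P]_x g i x.
Proof.
apply: EFin_inj.
rewrite /Rintegral fineK; last exact/integrable_fin_num/integrable_lincomb.
under eq_integral do rewrite -sumEFin.
rewrite integral_sum//; last first.
  by move=> i; apply: (integrableZl measurableT (a i) (g_int i)).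
rewrite -sumEFin; apply: eq_bigr => i _.
under eq_integral do rewrite EFinM.
rewrite integralZl//; last exact: g_int.
by rewrite EFinM fineK//; exact: (integrable_fin_num _ (g_int i)).
Qed.

(** The hypothesis says that, moving from q towards any value of g, one does
    not get closer to the mean p of g.  Hence <p - q, g x - q> <= 0 for all x,
    and the integral of this inequality is |p - q|^2 <= 0. *)
Lemma mean_eq_closest (q : I -> R) :
  (forall x t, 0 <= t <= 1 ->
     \sum_i (\int[P]_y g i y - q i) ^+ 2 <=
     \sum_i (\int[P]_y g i y - ((1 - t) * q i + t * g i x)) ^+ 2) ->
  forall i, q i = \int[P]_y g i y.
Proof.
move=> closest; pose p i := \int[P]_y g i y; pose a i := p i - q i.
have obtuse x : \sum_i a i * g i x <= \sum_i a i * q i.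
  rewrite -subr_le0 -sumrB.
  apply: (@quadratic_le0 _ _ (\sum_i (g i x - q i) ^+ 2)) => t t01.
  move: (closest x t t01) => h; rewrite -subr_ge0 -sumrB in h.
  rewrite -subr_ge0; apply: le_trans h _; rewrite !mulr_sumr -sumrB.
  by apply: ler_sum => i _; rewrite /a /p; lra.
have : \sum_i a i * p i <= \sum_i a i * q i.
  rewrite -Rintegral_lincomb -[leRHS]mulr1.
  have P1 : fine (P [set: T]) = 1 by rewrite probability_setT.
  rewrite -[X in _ * X]P1 -Rintegral_cst//.
  apply: le_Rintegral => //; first exact: integrable_lincomb.
  exact: finite_measure_integrable_cst.
rewrite -subr_le0 -sumrB => le0 i; apply/eqP; rewrite -subr_eq0 -opprB oppr_eq0.
suff /eqP : \sum_i a i ^+ 2 = 0.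
  rewrite psumr_eq0 => [/allP/(_ i (mem_index_enum i))|j _]; last exact: sqr_ge0.
  by rewrite /= sqrf_eq0.
apply/le_anti; rewrite sumr_ge0 ?andbT => [|j _]; last exact: sqr_ge0.
by apply: le_trans le0; apply: ler_sum => j _; rewrite /a; lra.
Qed.

End mean.

(** * Mixtures as probability measures *)

Section finite_mixture.
Context {d : measure_display} {T : measurableType d} {R : realType}.
Variables (N : nat) (th : nat -> R * T).

(** The absolute value makes this a measure whatever the sign of the weight. *)
Definition atom (j : nat) : {measure set T -> \bar R} :=
  mscale `|(th j).1|%:nng (\d_(th j).2).

Hypothesis th0 : forall j, 0 <= (th j).1.

Lemma ge0_integral_mixture (f : T -> R) :
  measurable_fun [set: T] f -> (forall x, 0 <= f x) ->
  (\int[msum atom N]_x (f x)%:E = (\sum_(j < N) (th j).1 * f (th j).2)%:E)%E.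
Proof.
move=> mf f0; move/measurable_EFinP: (mf) => mEf.
rewrite ge0_integral_measure_sum//; last by move=> x _; rewrite lee_fin.
rewrite -sumEFin; apply: eq_bigr => j _.
rewrite ge0_integral_mscale//; last by move=> x _; rewrite lee_fin.
by rewrite integral_dirac// diracT mul1e /= ger0_norm.
Qed.

Lemma Rintegral_mixture (f : T -> R) : measurable_fun [set: T] f ->
  \int[msum atom N]_x f x = \sum_(j < N) (th j).1 * f (th j).2.
Proof.
move=> mf; rewrite /Rintegral integralE.
rewrite -[fun x => (f x)%:E]/(EFin \o f) funerpos funerneg /=.
rewrite !ge0_integral_mixture/=; last 4 first.
- exact: measurable_funrneg.
- by move=> x; exact: funrneg_ge0.
- exact: measurable_funrpos.
- by move=> x; exact: funrpos_ge0.
rewrite -sumrB; apply: eq_bigr => j _.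
by rewrite -mulrBr -[in RHS](funrposBneg f).
Qed.

Lemma mixture_probability : \sum_(j < N) (th j).1 = 1 ->
  exists P : probability T R,
    (forall f, measurable_fun [set: T] f ->
       \int[P]_x f x = \sum_(j < N) (th j).1 * f (th j).2) /\
    (forall A, (forall j, (j < N)%N -> ~ A (th j).2) -> P A = 0).
Proof.
move=> th1.
have msumT : msum atom N [set: T] = 1%E.
  rewrite /msum -th1 -sumEFin; apply: eq_bigr => j _.
  by rewrite /= /mscale /= diracT mule1 ger0_norm.
pose P : probability T R := HB.pack_for (probability T R) (msum atom N)
  (Measure_isProbability.Build _ _ _ (msum atom N) msumT).
exists P; split=> [f mf|A AN]; first exact: Rintegral_mixture.
rewrite /P/= /msum big1// => j _.
by rewrite /= /mscale /= diracE memNset ?mule0//; exact: AN.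
Qed.

End finite_mixture.

(** * The simplex: topology, Borel functions and entropy *)

(** With s = sqrt x this is the bound ln (1 / s) < 1 / s, multiplied by
    2 s^2. *)
Lemma norm_xlnx_le (R : realType) (x : R) : x <= 1 ->
  `|x * ln x| <= 2 * Num.sqrt x.
Proof.
move=> x1; have [x0|x0] := leP x 0.
  by rewrite ln0// mulr0 normr0 mulr_ge0// sqrtr_ge0.
rewrite ler0_norm; last by rewrite mulr_ge0_le0 ?ln_le0// ltW.
have s0 : 0 < Num.sqrt x by rewrite sqrtr_gt0.
rewrite -{1 2}(sqr_sqrtr (ltW x0)) lnXn//.
have : ln (Num.sqrt x)^-1 < (Num.sqrt x)^-1.
  by apply: ln_sublinear; rewrite invr_gt0.
rewrite lnV ?posrE// -(ltr_pM2l s0) divff ?gt_eqF// => h.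
by rewrite expr2 mulr2n; nra.
Qed.

(** At 0 continuity follows from [norm_xlnx_le]; to the left of 0 the function
    is constant, as [ln] vanishes there. *)
Lemma continuous_xlnx (R : realType) : continuous (fun x : R => x * ln x).
Proof.
move=> x; have [x0|x0|->] := ltgtP x 0.
- apply: cvg_near_cst; near=> y.
  by rewrite !ln0 ?mulr0// ltW//; near: y; exact: lt_nbhsl.
- by apply: cvgM; [exact: cvg_id|exact: continuous_ln].
have sqrt0 : 2 * Num.sqrt y @[y --> (0:R)] --> (0:R).
  rewrite -[X in _ --> X](mulr0 2) -[X in _ * X]sqrtr0.
  by apply: cvgM; [exact: cvg_cst|exact: sqrt_continuous].
rewrite /continuous_at mul0r; apply: (squeeze_cvgr _ _ sqrt0); last first.
  by rewrite -[X in _ --> X]oppr0; apply: cvgN; exact: sqrt0.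
near=> y; rewrite -ler_norml; apply: norm_xlnx_le.
by apply: ltW; near: y; exact: lt_nbhsl.
Unshelve. all: by end_near. Qed.

Lemma set_type_compact (S : topologicalType) (A : set S) :
  compact A -> compact [set: set_type A].
Proof.
move=> cA G PG _.
have GA : ((set_val : set_type A -> S) @ G) A.
  by apply: (@filterE _ G) => s; exact: set_valP.
have [p [Ap clp]] := cA _ (fmap_proper_filter (set_val : set_type A -> S) PG) GA.
exists (exist _ p (mem_set Ap)); split=> // B C GB [_ [[W oW <-] Wp WC]].
have GvB : ((set_val : set_type A -> S) @ G) [set set_val b | b in B].
  by apply: (@filterS _ G) GB => b Bb; exists b.
have [_ [[b Bb <-] Wb]] := clp _ W GvB (open_nbhs_nbhs (conj oW Wp)).
by exists b; split=> //; exact: WC.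
Qed.

Section Delta_topology.
Context {R : realType} {X : finType} {X0 : (0 < #|X|)%N}.
Local Notation Delta := (Delta R X0).

Lemma Delta_sum1 (nu : Delta) : \sum_x nu x = 1.
Proof. by have [_ h] := set_valP nu; exact: h. Qed.

Lemma Delta_ext (nu nu' : Delta) : (forall x, nu x = nu' x) -> nu = nu'.
Proof. by move=> e; apply: val_inj; apply/funext => x; exact: e. Qed.

Lemma Delta_subsingleton (nu nu' : Delta) : (#|X| <= 1)%N -> nu = nu'.
Proof.
move=> /fintype_le1P X1.
have mass1 (nu0 : Delta) x : nu0 x = 1.
  rewrite -(Delta_sum1 nu0) (bigD1 x)//= big_pred0 ?addr0// => y.
  by rewrite (X1 x y) eqxx.
by apply: Delta_ext => x; rewrite !mass1.
Qed.

Lemma eval_continuous x : continuous (fun h : {ptws X -> R} => h x).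
Proof. exact: (@proj_continuous _ (fun _ : X => R) x). Qed.

Lemma val_continuous : continuous (set_val : Delta -> {ptws X -> R}).
Proof. exact: initial_continuous. Qed.

Lemma mass_continuous x : continuous (fun nu : Delta => nu x).
Proof. exact: continuous_compose val_continuous (@eval_continuous x). Qed.

Lemma closed_point (nu : Delta) : closed [set nu].
Proof.
rewrite (_ : [set nu] = \bigcap_(x in [set: X])
  ((fun nu' : Delta => nu' x) @^-1` [set nu x])); last first.
  apply/seteqP; split=> [_ -> //|nu' h]; apply: Delta_ext => x; exact: h.
apply: closed_bigI => x _.
by move/continuous_closedP: (@mass_continuous x); apply; exact: closed_eq.
Qed.

Lemma entropy_continuous : continuous (@entropy R X X0).
Proof.
have xlnx x : continuous (fun nu : Delta => nu x * ln (nu x)).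
  exact: continuous_compose (@mass_continuous x) (@continuous_xlnx R).
have sum_cont := @continuous_bigsum R _ _ (index_enum X) _ xlnx.
have opp_cont : continuous (fun r : R => - r) by exact: opp_continuous.
exact: (continuous_compose sum_cont opp_cont).
Qed.

Lemma simplex_compact : compact (@simplex R X).
Proof.
have box : compact [set h : {ptws X -> R} |
    forall x : X, `[0, 1]%classic (h x)].
  apply: (@tychonoff _ (fun _ : X => R) (fun _ => `[0, 1]%classic)) => _.
  exact: segment_compact.
apply: subclosed_compact box _; last first.
  move=> h [h0 h1] x; rewrite /= in_itv/= h0 -h1 (bigD1 x)//= lerDl.
  by apply: sumr_ge0 => y _; exact: h0.
have -> : @simplex R X =
    \bigcap_(x in [set: X])
       ((fun h : {ptws X -> R} => h x) @^-1` [set y | 0 <= y]) `&`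
    ((fun h : {ptws X -> R} => \sum_x h x) @^-1` [set 1]).
  apply/seteqP; split=> [h [h0 h1]|h [h0 h1]]; split=> // x.
    by move=> _; exact: h0.
  exact: (h0 x Logic.I).
apply: closedI.
  apply: closed_bigI => x _.
  by move/continuous_closedP: (@eval_continuous x); apply; exact: closed_ge.
have /continuous_closedP :=
  @continuous_bigsum R _ _ (index_enum X) _ eval_continuous.
apply; exact: closed_eq.
Qed.

Lemma Delta_compact : compact [set: Delta].
Proof. exact: set_type_compact simplex_compact. Qed.

Lemma continuous_borel (f : Delta -> R) :
  continuous f -> measurable_fun [set: Delta] f.
Proof.
move=> /continuousP cf; apply: (measurability _ (RGenOpens.measurableE R)).
move=> _ [_ [a [b ->] <-]]; rewrite setTI; apply: sub_sigma_algebra.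
exact/cf/interval_open.
Qed.

Lemma continuous_integrable (P : probability Delta R) (f : Delta -> R) :
  continuous f -> P.-integrable [set: Delta] (EFin \o f).
Proof.
move=> cf; apply: measurable_bounded_integrable => //.
- by rewrite (le_lt_trans (probability_le1 _ _))// ltry.
- exact: continuous_borel.
have /compact_bounded [M [Mr MP]] : compact (f @` [set: Delta]).
  apply: continuous_compact Delta_compact.
  exact: continuous_subspaceT.
by exists M; split=> // y My x _ /=; apply: MP => //; exists x.
Qed.

(** * Every mean is the mean of a finite mixture *)

(** The moments of a mixture minimizing the distance to the mean of g satisfy
    the hypothesis of [mean_eq_closest], since a mixture can be moved towards
    any point while remaining a mixture of #|I| points. *)
Lemma mean_is_mixture (I : finType) (g : I -> Delta -> R) (c : I -> R)
    (P : probability Delta R) :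
  (forall nu, \sum_i c i * g i nu = 1) -> (forall i, continuous (g i)) ->
  exists2 th, mixtures #|I| th &
    forall i, mixed g #|I| th i = \int[P]_nu g i nu.
Proof.
move=> c1 g_cont; pose p i := \int[P]_nu g i nu.
have mc := mixed_continuous g_cont.
have sqdist_cont : continuous
    (fun th : prod_topology (fun _ : nat => (R * Delta)%type) =>
       \sum_i (p i - mixed g #|I| th i) ^+ 2).
  apply: continuous_bigsum => i.
  have sq : continuous (fun r : R => (p i - r) ^+ 2).
    move=> r; apply: cvgM; apply: cvgB; try exact: cvg_cst; exact: cvg_id.
  exact: (continuous_compose (mc i) sq).
have [th0 th0M _] := mixtures_point c1 point.
have M0 : @mixtures R Delta #|I| !=set0 by exists th0.
have [th thM thmin] := compact_EVT_min M0
  (@mixtures_compact R Delta I Delta_compact) (continuous_subspaceT sqdist_cont).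
exists th; first exact: set_mem.
apply: mean_eq_closest => [i|nu t t01]; first exact: continuous_integrable.
have [th1 th1M th1E] := mixtures_point c1 nu.
have [th2 th2M th2E] := mixtures_convex c1 (set_mem thM) th1M t01.
have := thmin th2 (mem_set th2M).
by under [leRHS]eq_bigr do rewrite th2E th1E.
Qed.

(** The complement of the finite set of atoms is open and of measure zero, so
    the support consists of atoms. *)
Lemma probability_of_mixture (N : nat) (th : nat -> R * Delta) :
  (forall j, 0 <= (th j).1) -> \sum_(j < N) (th j).1 = 1 ->
  exists P : probability Delta R, supp P #<= `I_N /\
    forall f, continuous f ->
      \int[P]_nu f nu = \sum_(j < N) (th j).1 * f (th j).2.
Proof.
move=> th0 th1; have [P [intP nullP]] := mixture_probability th0 th1.
exists P; split; last by move=> f /continuous_borel; exact: intP.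
apply: card_le_trans (card_image_le (fun j => (th j).2) `I_N).
apply: subset_card_le => nu suppnu; apply: contrapT => nu_th.
pose U := ~` \bigcup_(j in `I_N) [set (th j).2].
have : (0 < P U)%E.
  apply: suppnu; last by move=> [j jN nuj]; apply: nu_th; exists j.
  apply: closed_openC; apply: closed_bigcup => [|j _]; last exact: closed_point.
  exact: finite_II.
by rewrite nullP ?ltxx// => j jN; apply; exists j.
Qed.

End Delta_topology.

(** * The optimal mixture *)

Section optimum.
Context {R : realType} {X : finType} {X0 : (0 < #|X|)%N}.
Local Notation Delta := (Delta R X0).
Variables (mu : Delta) (F : Delta -> R) (f : R -> R).
Hypotheses (F_cont : continuous F) (f_cont : continuous f).

Definition moment (i : X + bool) (nu : Delta) : R :=
  match i with inl x => nu x | inr true => F nu | inr false => entropy nu end.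

(** The coefficients that recover the total mass of [nu] from its moments. *)
Definition mass_weight (i : X + bool) : R := if i is inl _ then 1 else 0.

Lemma moment_continuous i : continuous (moment i).
Proof.
by case: i => [x|[]]; [exact: mass_continuous|exact: F_cont|
  exact: entropy_continuous].
Qed.

Lemma moment_normalized nu : \sum_i mass_weight i * moment i nu = 1.
Proof.
rewrite big_sumType/= [X in _ + X]big1 => [|i _]; last by rewrite mul0r.
by rewrite addr0; under eq_bigr do rewrite mul1r; exact: Delta_sum1.
Qed.

Local Notation N := #|{: X + bool}|.
Local Notation value th := (mixed moment N th (inr true) -
  f (entropy mu - mixed moment N th (inr false))).
Local Notation params := (prod_topology (fun _ : nat => (R * Delta)%type)).

Definition posteriors : set params :=
  [set th | mixtures N th /\ forall x, mixed moment N th (inl x) = mu x].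

Lemma posteriors_convex th th' t : posteriors th -> posteriors th' ->
  0 <= t <= 1 -> exists2 th'', posteriors th'' &
    forall i, mixed moment N th'' i =
      (1 - t) * mixed moment N th i + t * mixed moment N th' i.
Proof.
move=> [Mth muth] [Mth' muth'] t01.
have [th'' Mth'' th''E] := mixtures_convex moment_normalized Mth Mth' t01.
exists th'' => //; split=> // x; rewrite th''E muth muth'; ring.
Qed.

Lemma posteriors_of (P : probability Delta R) : feasible mu P ->
  exists2 th, posteriors th &
    forall i, mixed moment N th i = \int[P]_nu moment i nu.
Proof.
move=> Pmu.
have [th Mth thE] := mean_is_mixture P moment_normalized moment_continuous.
by exists th => //; split=> // x; rewrite thE; exact: Pmu.
Qed.

Lemma optimal_posteriors :
  exists2 th, posteriors th & forall th', posteriors th' -> value th' <= value th.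
Proof.
have mc := mixed_continuous moment_continuous.
have cpt : compact posteriors.
  have -> : posteriors = mixtures N `&` \bigcap_(x in [set: X])
     ((fun th : params => mixed moment N th (inl x)) @^-1` [set mu x]).
    apply/seteqP; split=> [th [Mth muth]|th [Mth muth]]; split=> // x.
      by move=> _; exact: muth.
    exact: (muth x Logic.I).
  apply: compact_closedI; first exact: mixtures_compact Delta_compact.
  apply: closed_bigI => x _.
  by move/continuous_closedP: (mc (inl x)); apply; exact: closed_eq.
have value_cont : continuous (fun th : params => value th).
  have cost : continuous (fun b : R => - f (entropy mu - b)).
    move=> b; apply: cvgN; apply: continuous_comp; last exact: f_cont.
    by apply: cvgB; [exact: cvg_cst|exact: cvg_id].
  have cost_mixed := continuous_compose (mc (inr false)) cost.
  exact: continuous_add (mc (inr true)) cost_mixed.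
(* The point mass at mu shows that the feasible set is not empty. *)
have [th0 th0M th0E] := mixtures_point moment_normalized mu.
have nonempty : posteriors !=set0 by exists th0; split=> // x; rewrite th0E.
have [th /set_mem thP thmax] :=
  compact_EVT_max nonempty cpt (continuous_subspaceT value_cont).
by exists th => // th' th'P; apply: thmax; exact: mem_set.
Qed.

End optimum.

(** * First-order condition and conclusion *)

(** Division by t turns the hypothesis into a lower bound A on the difference
    quotients of f at s in the direction -B, whose limit is -B f'(s). *)
Lemma one_sided_derivative_bound (R : realType) (f : R -> R) (s A B : R) :
  derivable f s 1 ->
  (forall t, 0 < t <= 1 -> t * A <= f (s - t * B) - f s) ->
  A + derive1 f s * B <= 0.
Proof.
move=> /derivable1_diffP df h.
have quot : h^-1 *: ((f \o shift s) (h *: (- B)) - f s) @[h --> 0^'] -->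
    'D_(- B) f s.
  exact: diff_derivable.
rewrite deriveE// diff1E// in quot.
rewrite -[_ * _]opprK -mulrN mulrC -[_ * _]/(_ *: _) subr_le0.
apply: (cvgr_to_ge (cvg_dnbhs_at_right quot)).
near=> t.
have t0 : 0 < t by near: t; exact: nbhs_right_gt.
have t1 : t <= 1 by near: t; exact: nbhs_right_le.
rewrite /= -[_ *: _]/(_ * _) -[t *: _]/(_ * _) ler_pdivlMl//.
by rewrite (_ : t * - B + s = s - t * B) ?h ?t0//; ring.
Unshelve. all: by end_near. Qed.

Theorem proposition1 (R : realType) (X : finType) (X0 : (0 < #|X|)%N)
    (mu : Delta R X0) (A : Type) (u : A -> X -> R) (F : Delta R X0 -> R)
    (F_max : forall nu : Delta R X0,
       is_max (range (expected_utility u nu)) (F nu))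
    (F_cont : continuous F)
    (f : R -> R) (f_cont : continuous f)
    (f_convex : convex_function (setT : set R^o) f) :
  exists Pstar : probability (Delta R X0) R,
    [/\ supp Pstar #<= `I_(2 * #|X|)%N,
        solves_sup (feasible mu)
          (fun P : probability (Delta R X0) R =>
             \int[P]_nu F nu - f (\int[P]_nu (entropy mu - entropy nu)))
          Pstar
      & (forall t : R, derivable f t 1) ->
        argmax (feasible mu)
          (fun P : probability (Delta R X0) R =>
             \int[P]_nu
               (F nu + derive1 f (\int[Pstar]_nu' (entropy mu - entropy nu'))
                      * entropy nu))
          Pstar].
Proof.
have [th [Mth muth] th_opt] := optimal_posteriors mu F_cont f_cont.
have th0 j : 0 <= (th j).1 by case: Mth => /(_ j)/andP[].
have [P [suppP meanP]] := probability_of_mixture th0 (proj2 Mth).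
have momentP i : \int[P]_nu moment F i nu = mixed (moment F) #|{: X + bool}| th i.
  exact: meanP (@moment_continuous R X X0 F F_cont i).
have Hint (Q : probability (Delta R X0) R) :=
  continuous_integrable Q (@entropy_continuous R X X0).
have infoE (Q : probability (Delta R X0) R) :
    \int[Q]_nu (entropy mu - entropy nu) = entropy mu - \int[Q]_nu entropy nu.
  rewrite RintegralB//; last 2 first.
  - exact: finite_measure_integrable_cst.
  - exact: Hint.
  have Q1 : fine (Q [set: Delta R X0]) = 1 by rewrite probability_setT.
  by rewrite Rintegral_cst// Q1 mulr1.
have Pmu : feasible mu P by move=> x; rewrite -muth -momentP.
have PF : \int[P]_nu F nu = _ := momentP (inr true).
have PH : \int[P]_nu entropy nu = _ := momentP (inr false).
exists P; split.
- have [X2|X1] := leqP 2 #|X|.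
    apply: card_le_trans suppP _; rewrite card_le_II card_sum card_bool.
    by rewrite mul2n -addnn leq_add2l.
  apply: card_le_trans (card_image_le (fun=> mu) `I_(2 * #|X|)).
  apply: subset_card_le => nu _; exists 0%N; first by rewrite /= muln_gt0.
  exact: Delta_subsingleton.
- split=> //; apply/eqP; rewrite eq_le; apply/andP; split.
    by apply: ereal_sup_ubound; exists P.
  apply: ge_ereal_sup => _ [Q Qmu <-]; rewrite lee_fin !infoE PF PH.
  have [thQ /th_opt + thQE] := posteriors_of F_cont Qmu.
  by rewrite !thQE.
- move=> df; split=> // Q Qmu.
  set k := derive1 f _.
  have linE (P' : probability (Delta R X0) R) :
      \int[P']_nu (F nu + k * entropy nu) =
      \int[P']_nu F nu + k * \int[P']_nu entropy nu.
    rewrite RintegralD//; last 2 first.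
    - exact: continuous_integrable.
    - exact: (integrableZl measurableT k (Hint P')).
    by rewrite RintegralZl//; exact: Hint.
  rewrite !linE.
  have [thQ thQP thQE] := posteriors_of F_cont Qmu.
  have := @one_sided_derivative_bound R f (entropy mu - \int[P]_nu entropy nu)
    (\int[Q]_nu F nu - \int[P]_nu F nu)
    (\int[Q]_nu entropy nu - \int[P]_nu entropy nu) (df _).
  rewrite -infoE -/k => bound.
  suff /bound : forall t, 0 < t <= 1 ->
     t * (\int[Q]_nu F nu - \int[P]_nu F nu) <=
     f (\int[P]_nu (entropy mu - entropy nu) -
        t * (\int[Q]_nu entropy nu - \int[P]_nu entropy nu)) -
     f (\int[P]_nu (entropy mu - entropy nu)) by lra.
  (* Compare the optimum with the point at parameter t of the segment from P to
     Q in the space of moments. *)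
  move=> t /andP[t0 t1].
  have t01 : 0 <= t <= 1 by rewrite ltW.
  have [tht thtP thtE] := posteriors_convex (conj Mth muth) thQP t01.
  have := th_opt tht thtP; rewrite !thtE !thQE/= -PF -PH infoE.
  rewrite (_ : entropy mu - ((1 - t) * _ + _) =
    entropy mu - \int[P]_nu entropy nu -
    t * (\int[Q]_nu entropy nu - \int[P]_nu entropy nu)); last by ring.
  lra.
Qed.
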